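(* Let $m\geq 1$, let $Y$ be a connected $\Theta_{n-1}$-space, and let $X\hookrightarrow Y$ be a monomorphism in $\mathrm{sSet}^{\Theta_{n-1}^{\mathrm{op}}}$. For all $\theta\in\Theta_{n-1}$ and $k\ge0$, the functor $$(Q_{-,\theta,k})_!\colon \mathrm{Nec}(P_m(X\hookrightarrow Y)_{-,\theta,k})^{\mathrm{tnd}}_{0,m}\to\mathrm{Nec}(F[m])^{\mathrm{tnd}}_{0,m}$$ is a discrete fibration.
   Context: Fix an integer $n\ge1$. $\Theta_0$ is the terminal category and $\Theta_k=\Delta\wr\Theta_{k-1}$ for $k\ge1$ (Joyal's cell categories). A $\Theta_{n-1}$-space is an object $X$ of $\mathrm{sSet}^{\Theta_{n-1}^{\mathrm{op}}}$, with sets $X_{\theta,k}$; it is connected if $\pi_0X$ is a one-point set, where $\pi_0$ is the left adjoint of the inclusion of sets as constant presheaves. Objects $W$ of $\mathrm{sSet}^{\Theta_{n-1}^{\mathrm{op}}\times\Delta^{\mathrm{op}}}$ have sets $W_{m,\theta,k}$; $W_m$ is the $\Theta_{n-1}$-space $W_{m,\star,\star}$ and $W_{-,\theta,k}$ is a simplicial set. Simplicial sets in the first variable (e.g. the representable $F[m]$ and its boundary $\partial F[m]$) and $\Theta_{n-1}$-spaces are viewed as objects of this category, constant in the missing variables. $\mathcal P\mathrm{Cat}(\mathrm{sSet}^{\Theta_{n-1}^{\mathrm{op}}})$ is the full subcategory of those $W$ with $W_0$ discrete (constant on a set), and $L$ is the left adjoint of the inclusion. **$P_m$ and $Q$.**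 For $m\ge1$ and a monomorphism $X\hookrightarrow Y$ of $\Theta_{n-1}$-spaces, $P_m(X\hookrightarrow Y)$ is the pushout $L(\partial F[m]\times Y)\amalg_{L(\partial F[m]\times X)}L(F[m]\times X)$ in $\mathcal P\mathrm{Cat}(\mathrm{sSet}^{\Theta_{n-1}^{\mathrm{op}}})$. The map $Q\colon P_m(X\hookrightarrow Y)\to F[m]$ is induced by the projections of $\partial F[m]\times Y$ and $F[m]\times X$ to $\partial F[m]\subseteq F[m]$ and $F[m]$. When $Y$ is connected, $P_m(X\hookrightarrow Y)_0=\{0,1,\ldots,m\}$, and $P_m(X\hookrightarrow Y)_{-,\theta,k}$ is the quotient of $(\coprod_{Y_{\theta,k}\setminus X_{\theta,k}}\partial F[m])\amalg(\coprod_{X_{\theta,k}}F[m])$ identifying, for each $0\le i\le m$, all copies of the vertex $i$. **Necklaces.** A necklace is a simplicial set $T=F[m_1]\vee\cdots\vee F[m_t]$ obtained by gluing the last vertex of $F[m_i]$ to the first vertex of $F[m_{i+1}]$ (with $m_i>0$ for all $i$ if $t>1$), bi-pointed at its initial vertex $\alpha$ and final vertex $\omega$; the $F[m_i]$ are its beads. For a simplicial set $K$ and $a,b\in K_0$, $\mathrm{Nec}(K)_{a,b}$ is the category of bi-pointed maps $T\to K_{a,b}$ from necklaces to $K$ bi-pointed at $(a,b)$, with bi-pointed maps over $K_{a,b}$ as morphisms; $\mathrm{Nec}(K)^{\mathrm{tnd}}_{a,b}$ is the full subcategory of totally non-degenerate necklaces, i.e. those whose restriction to each bead $F[m_i]$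 is a non-degenerate $m_i$-simplex of $K$. $(Q_{-,\theta,k})_!$ is post-composition with $Q_{-,\theta,k}$, which sends non-degenerate simplices to non-degenerate simplices and hence is well defined on totally non-degenerate necklaces. A functor $p\colon E\to B$ is a discrete fibration if for every object $e\in E$ and morphism $f\colon b\to p(e)$ in $B$ there is a unique morphism of $E$ with target $e$ lying over $f$. *)

(* Defs.v *)
From mathcomp Require Import all_boot.
From mathcomp Require Import boolp.
From Stdlib Require List.

Set Implicit Arguments.
Unset Strict Implicit.
Unset Printing Implicit Defensive.
#[local] Obligation Tactic := idtac.

Record category := Category {
  obj :> Type;
  hom : obj -> obj -> Type;
  idm : forall a, hom a a;
  ccomp : forall a b c, hom b c -> hom a b -> hom a c;
  ccompA : forall a b c d (h : hom c d) (g : hom b c) (f : hom a b),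
    ccomp h (ccomp g f) = ccomp (ccomp h g) f;
  ccomp1m : forall a b (f : hom a b), ccomp (idm b) f = f;
  ccompm1 : forall a b (f : hom a b), ccomp f (idm a) = f }.

Arguments hom {_} _ _.
Arguments idm {_} _.
Arguments ccomp {_ _ _ _} _ _.
Notation "g ∘ f" := (ccomp g f) (at level 40, left associativity).

Record functor (C D : category) := Functor {
  fobj :> C -> D;
  fmap : forall a b, hom a b -> hom (fobj a) (fobj b);
  fmap1 : forall a, fmap (idm a) = idm (fobj a);
  fmapM : forall a b c (g : hom b c) (f : hom a b),
    fmap (g ∘ f) = fmap g ∘ fmap f }.

Arguments fmap {_ _} _ {_ _} _.

Record nattrans (C D : category) (F G : functor C D) := NatTrans {
  ntob :> forall a, hom (F a) (G a);
  ntnat : forall a b (f : hom a b), ntob b ∘ fmap F f = fmap G f ∘ ntob a }.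

Lemma nt_eq (C D : category) (F G : functor C D) (s t : nattrans F G) :
  (forall a, s a = t a) -> s = t.
Proof.
case: s t => [s sn] [t tn] /= st.
have {}st : s = t by exact: functional_extensionality_dep.
by move: sn tn; rewrite st => sn tn; congr NatTrans; exact: Prop_irrelevance.
Qed.

Program Definition op (C : category) : category :=
  @Category C (fun a b => hom b a) (@idm C) (fun a b c g f => f ∘ g) _ _ _.
Next Obligation. by move=> C a b c d h g f /=; rewrite ccompA. Qed.
Next Obligation. by move=> C a b f /=; rewrite ccompm1. Qed.
Next Obligation. by move=> C a b f /=; rewrite ccomp1m. Qed.

Program Definition prod_cat (C D : category) : category :=
  @Category (C * D)%type (fun a b => (hom a.1 b.1 * hom a.2 b.2)%type)
    (fun a => (idm a.1, idm a.2))
    (fun a b c g f => (g.1 ∘ f.1, g.2 ∘ f.2)) _ _ _.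
Next Obligation. by move=> C D a b c d h g f /=; rewrite !ccompA. Qed.
Next Obligation. by move=> C D a b [f g] /=; rewrite !ccomp1m. Qed.
Next Obligation. by move=> C D a b [f g] /=; rewrite !ccompm1. Qed.

Program Definition fun_cat (C D : category) : category :=
  @Category (functor C D) (@nattrans C D)
    (fun F => @NatTrans C D F F (fun a => idm (F a)) _)
    (fun F G H t s => @NatTrans C D F H (fun a => t a ∘ s a) _) _ _ _.
Next Obligation. by move=> C D F a b f; rewrite ccomp1m ccompm1. Qed.
Next Obligation.
by move=> C D F G H t s a b f; rewrite -ccompA ntnat ccompA ntnat ccompA.
Qed.
Next Obligation.
by move=> C D F G H K u t s; apply: nt_eq => a /=; rewrite ccompA.
Qed.
Next Obligation. by move=> C D F G s; apply: nt_eq => a /=; rewrite ccomp1m. Qed.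
Next Obligation. by move=> C D F G s; apply: nt_eq => a /=; rewrite ccompm1. Qed.

Program Definition full_sub (C : category) (P : C -> Prop) : category :=
  @Category {a : C | P a} (fun a b => hom (sval a) (sval b))
    (fun a => idm (sval a)) (fun a b c g f => g ∘ f) _ _ _.
Next Obligation. by move=> C P a b c d h g f /=; rewrite ccompA. Qed.
Next Obligation. by move=> C P a b f /=; rewrite ccomp1m. Qed.
Next Obligation. by move=> C P a b f /=; rewrite ccompm1. Qed.

Definition full_incl (C : category) (P : C -> Prop) : functor (full_sub P) C :=
  @Functor (full_sub P) C sval (fun a b f => f)
    (fun=> erefl) (fun _ _ _ _ _ => erefl).

Program Definition full_restrict (C D : category) (F : functor C D)
    (P : C -> Prop) (R : D -> Prop) (PR : forall a, P a -> R (F a)) :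
    functor (full_sub P) (full_sub R) :=
  @Functor (full_sub P) (full_sub R)
    (fun a => exist R (F (sval a)) (PR _ (svalP a)))
    (fun a b f => fmap F f) _ _.
Next Obligation. by move=> C D F P R PR a /=; rewrite fmap1. Qed.
Next Obligation. by move=> C D F P R PR a b c g f /=; rewrite fmapM. Qed.

Section Notions.
Variables C D : category.

Definition is_iso (a b : C) (f : hom a b) :=
  exists g : hom b a, g ∘ f = idm a /\ f ∘ g = idm b.

Definition mono (a b : C) (f : hom a b) :=
  forall z (g h : hom z a), f ∘ g = f ∘ h -> g = h.

Definition is_pushout (a b c p : C) (f : hom a b) (g : hom a c)
    (l : hom b p) (r : hom c p) :=
  l ∘ f = r ∘ g /\
  forall z (u : hom b z) (v : hom c z), u ∘ f = v ∘ g ->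
    exists! h : hom p z, h ∘ l = u /\ h ∘ r = v.

Definition universal_arrow (G : functor D C) (c : C) (d : D)
    (u : hom c (G d)) :=
  forall d' (f : hom c (G d')), exists! g : hom d d', fmap G g ∘ u = f.

Record adjunction (L : functor C D) (G : functor D C) := Adjunction {
  unit_adj : forall c, hom c (G (L c));
  unit_nat : forall a b (f : hom a b),
    unit_adj b ∘ f = fmap G (fmap L f) ∘ unit_adj a;
  unit_univ : forall c, universal_arrow (unit_adj c) }.

Definition discrete_fibration (p : functor C D) :=
  forall (e : C) (b : D) (f : hom b (p e)),
    exists! x : {e' : C & hom e' e},
      existT (fun b' => hom b' (p e)) (p (projT1 x)) (fmap p (projT2 x))
      = existT _ b f.

End Notions.

Definition set_cat : category :=
  @Category Type (fun A B => A -> B) (fun A x => x) (fun A B E g f x => g (f x))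
    (fun _ _ _ _ _ _ _ => erefl) (fun _ _ _ => erefl) (fun _ _ _ => erefl).

Definition psh (C : category) : category := fun_cat (op C) set_cat.

Section Psh.
Variable C : category.

Definition res (X : psh C) (a b : C) (f : hom a b) (x : X b) : X a :=
  @fmap (op C) set_cat X b a f x.

Lemma res1 (X : psh C) (a : C) (x : X a) : res (idm a) x = x.
Proof.
exact: (congr1 (fun h : X a -> X a => h x) (@fmap1 (op C) set_cat X a)).
Qed.

Lemma resM (X : psh C) (a b c : C) (g : hom b c) (f : hom a b) (x : X c) :
  res (g ∘ f) x = res f (res g x).
Proof.
exact: (congr1 (fun h : X c -> X a => h x) (@fmapM (op C) set_cat X _ _ _ f g)).
Qed.

Definition papp (X Y : psh C) (t : hom X Y) (a : C) (x : X a) : Y a := ntob t a x.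

Lemma papp_res (X Y : psh C) (t : hom X Y) (a b : C) (f : hom a b) (x : X b) :
  papp t (res f x) = res f (papp t x).
Proof. exact: (congr1 (fun h : X b -> Y a => h x) (@ntnat (op C) set_cat X Y t b a f)). Qed.

Lemma pmap_eq (X Y : psh C) (s t : hom X Y) :
  (forall (a : C) (x : X a), papp s x = papp t x) -> s = t.
Proof. by move=> st; apply: nt_eq => a; apply: funext => x; exact: st. Qed.

Program Definition mk_psh (X : C -> Type)
    (r : forall a b : C, hom a b -> X b -> X a)
    (r1 : forall a x, r a a (idm a) x = x)
    (rM : forall a b c (g : hom b c) (f : hom a b) x,
      r a c (g ∘ f) x = r a b f (r b c g x)) : psh C :=
  @Functor (op C) set_cat X (fun a b f => r b a f) _ _.
Next Obligation. by move=> X r r1 rM a /=; apply: funext => x; exact: r1. Qed.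
Next Obligation.
by move=> X r r1 rM a b c g f /=; apply: funext => x; exact: rM.
Qed.

Program Definition mk_pmap (X Y : psh C) (t : forall a : C, X a -> Y a)
    (tn : forall (a b : C) (f : hom a b) (x : X b), t a (res f x) = res f (t b x)) :
    hom X Y :=
  @NatTrans (op C) set_cat X Y t _.
Next Obligation.
by move=> X Y t tn a b f /=; apply: funext => x; exact: tn.
Qed.

Definition const_psh_ob (S : Type) : psh C :=
  @mk_psh (fun=> S) (fun _ _ _ s => s) (fun _ _ => erefl)
    (fun _ _ _ _ _ _ => erefl).

Program Definition const_psh : functor set_cat (psh C) :=
  @Functor set_cat (psh C) const_psh_ob
    (fun S S' h => @mk_pmap (const_psh_ob S) (const_psh_ob S') (fun=> h) _) _ _.
Next Obligation. by []. Qed.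
Next Obligation. by move=> S; apply: pmap_eq. Qed.
Next Obligation. by move=> S S' S'' g f; apply: pmap_eq. Qed.

Definition discrete (X : psh C) :=
  exists (S : set_cat) (f : hom X (const_psh S)), is_iso f.

(* The left adjoint [pi_0] of [const_psh], evaluated at [X], is a point. *)
Definition connected (X : psh C) :=
  exists (S : set_cat) (u : hom X (const_psh S)),
    universal_arrow u /\ exists s : S, forall s', s' = s.

Program Definition prod_psh (X Y : psh C) : psh C :=
  @mk_psh (fun a => (X a * Y a)%type)
    (fun a b f p => (res f p.1, res f p.2)) _ _.
Next Obligation. by move=> X Y a [x y]; rewrite /= !res1. Qed.
Next Obligation. by move=> X Y a b c g f [x y]; rewrite /= !resM. Qed.

Program Definition prod_pmap (X Y X' Y' : psh C) (f : hom X X') (g : hom Y Y') :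
    hom (prod_psh X Y) (prod_psh X' Y') :=
  @mk_pmap (prod_psh X Y) (prod_psh X' Y')
    (fun a p => (papp f p.1, papp g p.2)) _.
Next Obligation.
by move=> X Y X' Y' f g a b h [x y]; rewrite /res /= -!/(res _ _) !papp_res.
Qed.

Definition proj1_psh (X Y : psh C) : hom (prod_psh X Y) X :=
  @mk_pmap (prod_psh X Y) X (fun a p => p.1) (fun _ _ _ _ => erefl).

Program Definition sub_psh (X : psh C) (P : forall a : C, X a -> Prop)
    (PR : forall (a b : C) (f : hom a b) (x : X b), P b x -> P a (res f x)) : psh C :=
  @mk_psh (fun a => {x : X a | P a x})
    (fun a b f x => exist (P a) (res f (sval x)) (PR a b f _ (svalP x))) _ _.
Next Obligation. by move=> X P PR a [x Px]; apply: eq_exist; rewrite res1. Qed.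
Next Obligation.
by move=> X P PR a b c g f [x Px]; apply: eq_exist; rewrite /= resM.
Qed.

Definition sub_incl (X : psh C) (P : forall a : C, X a -> Prop) PR :
    hom (@sub_psh X P PR) X :=
  @mk_pmap (sub_psh PR) X (fun a x => sval x) (fun _ _ _ _ => erefl).

End Psh.

Arguments res {C X a b} _ _.
Arguments papp {C X Y} _ {a} _.

Program Definition precomp_ob (C D : category) (F : functor C D) (X : psh D) :
    psh C :=
  @mk_psh C (fun a => X (F a)) (fun a b f => res (fmap F f)) _ _.
Next Obligation. by move=> C D F X a x /=; rewrite fmap1 res1. Qed.
Next Obligation. by move=> C D F X a b c g f x /=; rewrite fmapM resM. Qed.

Program Definition precomp (C D : category) (F : functor C D) :
    functor (psh D) (psh C) :=
  @Functor (psh D) (psh C) (precomp_ob F)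
    (fun X Y t => @mk_pmap C (precomp_ob F X) (precomp_ob F Y)
                    (fun a (x : X (F a)) => papp t x) _) _ _.
Next Obligation.
by move=> C D F X Y t a b f x; exact: (papp_res t (fmap F f)).
Qed.
Next Obligation. by move=> C D F X; apply: pmap_eq. Qed.
Next Obligation. by move=> C D F X Y Z t s; apply: pmap_eq. Qed.

Definition fst_functor (C D : category) : functor (prod_cat C D) C :=
  @Functor (prod_cat C D) C fst (fun _ _ f => f.1) (fun=> erefl)
    (fun _ _ _ _ _ => erefl).

Definition snd_functor (C D : category) : functor (prod_cat C D) D :=
  @Functor (prod_cat C D) D snd (fun _ _ f => f.2) (fun=> erefl)
    (fun _ _ _ _ _ => erefl).

Program Definition left_at (C D : category) (c : C) :
    functor D (prod_cat C D) :=
  @Functor D (prod_cat C D) (fun d => (c, d)) (fun _ _ f => (idm c, f)) _ _.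
Next Obligation. by []. Qed.
Next Obligation. by move=> C D c x y z g f /=; rewrite ccomp1m. Qed.

Program Definition right_at (C D : category) (d : D) :
    functor C (prod_cat C D) :=
  @Functor C (prod_cat C D) (fun c => (c, d)) (fun _ _ f => (f, idm d)) _ _.
Next Obligation. by []. Qed.
Next Obligation. by move=> C D d x y z g f /=; rewrite ccomp1m. Qed.

(* The object [m] of the simplex category is the ordinal {0 < ... < m}. *)

Record dmap (m q : nat) := DMap {
  dfun :> 'I_m.+1 -> 'I_q.+1;
  dmono : {homo dfun : i j / i <= j} }.

Lemma dmap_eq m q (f g : dmap m q) : f =1 g -> f = g.
Proof.
case: f g => [f fm] [g gm] /= fg; have {}fg : f = g by exact: funext.
by move: fm gm; rewrite fg => fm gm; congr DMap; exact: Prop_irrelevance.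
Qed.

Definition dmap_comp m q r (g : dmap q r) (f : dmap m q) : dmap m r :=
  @DMap m r (fun i => g (f i)) (fun i j ij => dmono g (dmono f ij)).

Definition dmap_id m : dmap m m := @DMap m m (fun i => i) (fun i j ij => ij).

Program Definition Delta : category :=
  @Category nat dmap dmap_id (fun _ _ _ g f => dmap_comp g f) _ _ _.
Next Obligation. by move=> *; apply: dmap_eq. Qed.
Next Obligation. by move=> *; apply: dmap_eq. Qed.
Next Obligation. by move=> *; apply: dmap_eq. Qed.

Definition dmap_const m q (i : 'I_q.+1) : dmap m q :=
  @DMap m q (fun=> i) (fun _ _ _ => leqnn i).

Section Wreath.
Variable C : category.

(* [existT m c] is [m](c_1, ..., c_m); [c i] decorates the edge from [i] to
   [i + 1] of the ordinal [m]. *)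
Definition wobj := {m : nat & 'I_m -> C}.

(* [f] maps the [i]-th edge of its source onto an interval containing the
   [j]-th edge of its target. *)
Definition covers m q (f : dmap m q) (i : 'I_m) (j : 'I_q) : bool :=
  f (widen_ord (leqnSn m) i) <= j < f (lift ord0 i).

Record whom (a b : wobj) := WHom {
  wbase : dmap (projT1 a) (projT1 b);
  wdec : forall i j, covers wbase i j -> hom (projT2 a i) (projT2 b j) }.

Lemma whom_eq a b (f g : whom a b) : wbase f =1 wbase g ->
  (forall i j hf hg, @wdec _ _ f i j hf = @wdec _ _ g i j hg) -> f = g.
Proof.
case: f g => [f fd] [g gd] /= /dmap_eq fg; move: fd gd; rewrite fg => fd gd fgd.
congr WHom; apply: functional_extensionality_dep => i.
apply: functional_extensionality_dep => j.
by apply: functional_extensionality_dep => h; exact: fgd.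
Qed.

Lemma covers_comp m q r (g : dmap q r) (f : dmap m q) i l :
  covers (dmap_comp g f) i l -> {j | covers f i j & covers g j l}.
Proof.
rewrite /covers /= => /andP[gl lg].
have [j /andP[fj gj]] : {j | covers f i j && covers g j l}; last by exists j.
apply: sigW.
have ex : exists k, l < g (inord k).
  by exists (f (lift ord0 i)); rewrite inord_val.
case: (ex_minnP ex) => k lk kmin.
have kf : k <= f (lift ord0 i) by apply: kmin; rewrite inord_val.
have fk : f (widen_ord (leqnSn m) i) < k.
  rewrite ltnNge; apply/negP => kf'.
  have kq : (inord k : 'I_q.+1) <= f (widen_ord (leqnSn m) i).
    by rewrite inordK // (leq_ltn_trans kf).
  by have := leq_trans lk (leq_trans (dmono g kq) gl); rewrite ltnn.
have k0 : 0 < k by exact: leq_ltn_trans fk.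
have kq : k.-1 < q.
  by rewrite prednK //; have := ltn_ord (f (lift ord0 i)); exact: leq_ltn_trans.
exists (Ordinal kq); rewrite /covers /= -ltnS prednK // fk /= kf /=.
apply/andP; split.
  rewrite leqNgt; apply/negP => h; have := kmin k.-1.
  have -> : inord k.-1 = widen_ord (leqnSn q) (Ordinal kq).
    by apply: val_inj; rewrite /= inordK // ltnS ltnW.
  by move=> /(_ h); rewrite leqNgt prednK // leqnn.
have -> // : lift ord0 (Ordinal kq) = inord k.
apply: val_inj; rewrite /= /bump leq0n add1n prednK // inordK //.
by rewrite (leq_ltn_trans kf).
Qed.

Lemma covers_inj q r (g : dmap q r) j j' l :
  covers g j l -> covers g j' l -> j = j'.
Proof.
move=> /andP[gj jg] /andP[gj' jg']; apply: val_inj => /=; apply/eqP.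
rewrite eqn_leq; apply/andP; split; rewrite leqNgt; apply/negP => jj.
- have jj' : lift ord0 j' <= widen_ord (leqnSn q) j by rewrite /= /bump leq0n.
  by have := leq_trans jg' (leq_trans (dmono g jj') gj); rewrite ltnn.
- have jj' : lift ord0 j <= widen_ord (leqnSn q) j' by rewrite /= /bump leq0n.
  by have := leq_trans jg (leq_trans (dmono g jj') gj'); rewrite ltnn.
Qed.

Definition whom_comp a b c (g : whom b c) (f : whom a b) : whom a c :=
  @WHom a c (dmap_comp (wbase g) (wbase f)) (fun i l h =>
    let: exist2 j fj gj := covers_comp h in wdec gj ∘ wdec fj).

Lemma whom_compE a b c (g : whom b c) (f : whom a b) i j l h
    (fj : covers (wbase f) i j) (gj : covers (wbase g) j l) :
  @wdec _ _ (whom_comp g f) i l h = wdec gj ∘ wdec fj.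
Proof.
rewrite /=; case: covers_comp => j' fj' gj'.
have jj := covers_inj gj' gj; move: fj' gj'; rewrite jj => fj' gj'.
by rewrite (bool_irrelevance fj' fj) (bool_irrelevance gj' gj).
Qed.

Lemma covers_id m (i j : 'I_m) : covers (dmap_id m) i j -> i = j.
Proof.
rewrite /covers /= /bump leq0n add1n ltnS -eqn_leq => /eqP ij.
exact: val_inj.
Qed.

Definition whom_id (a : wobj) : whom a a :=
  @WHom a a (dmap_id (projT1 a)) (fun i j h =>
    ecast j (hom (projT2 a i) (projT2 a j)) (covers_id h) (idm _)).

Lemma covers_id_refl (a : wobj) i : covers (wbase (whom_id a)) i i.
Proof. by rewrite /covers /= /bump leq0n add1n ltnSn leqnn. Qed.

Lemma whom_idE a i h : @wdec _ _ (whom_id a) i i h = idm _.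
Proof. by rewrite /=; rewrite (Prop_irrelevance (covers_id h) erefl). Qed.

Program Definition wreath : category :=
  @Category wobj whom whom_id (fun _ _ _ g f => whom_comp g f) _ _ _.
Next Obligation.
move=> a b c d h g f; apply: whom_eq => // i l H1 H2.
have [j fj gj] := covers_comp (H2 : covers (dmap_comp (wbase (whom_comp h g)) (wbase f)) i l).
have [k gk hk] := covers_comp (gj : covers (dmap_comp (wbase h) (wbase g)) j l).
have fk : covers (wbase (whom_comp g f)) i k.
  move: fj gk; rewrite /covers /= => /andP[fj1 fj2] /andP[gk1 gk2].
  have j1 : wbase f (widen_ord (leqnSn _) i) <= widen_ord (leqnSn _) j by [].
  have j2 : lift ord0 j <= wbase f (lift ord0 i) by rewrite /= /bump leq0n.
  by rewrite (leq_trans (dmono _ j1) gk1) (leq_trans gk2 (dmono _ j2)).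
rewrite (whom_compE _ fk hk) (whom_compE _ fj gj).
by rewrite (whom_compE _ fj gk) (whom_compE _ gk hk) ccompA.
Qed.
Next Obligation.
move=> a b f; apply: whom_eq => // i j h h'.
rewrite (whom_compE _ h' (covers_id_refl j)) whom_idE.
by rewrite ccomp1m.
Qed.
Next Obligation.
move=> a b f; apply: whom_eq => // i j h h'.
rewrite (whom_compE _ (covers_id_refl i) h') whom_idE.
by rewrite ccompm1.
Qed.

End Wreath.

Definition terminal_cat : category :=
  @Category unit (fun _ _ => unit) (fun=> tt) (fun _ _ _ _ _ => tt)
    (fun _ _ _ _ _ _ _ => erefl)
    (fun _ _ f => let: tt := f in erefl) (fun _ _ f => let: tt := f in erefl).

Fixpoint Theta (n : nat) : category :=
  if n is k.+1 then wreath (Theta k) else terminal_cat.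

Definition sset : category := psh Delta.

Definition sres (K : sset) i j (f : dmap i j) (x : K j) : K i :=
  @res Delta K i j f x.

Program Definition simplex (m : nat) : sset :=
  @mk_psh Delta (fun j => dmap j m) (fun _ _ f s => dmap_comp s f) _ _.
Next Obligation. by move=> *; apply: dmap_eq. Qed.
Next Obligation. by move=> *; apply: dmap_eq. Qed.

Notation "'F[' m ]" := (simplex m) (format "'F[' m ]").

Definition vertex m (i : 'I_m.+1) : F[m] 0 := dmap_const 0 i.

(* the union of the faces of [F[m]] *)
Definition in_boundary m j (s : F[m] j) := exists i, forall x, dfun s x != i.

Program Definition boundary (m : nat) : sset :=
  @sub_psh Delta F[m] (@in_boundary m) _.
Next Obligation. by move=> m a b f s [i si]; exists i => x; exact: si. Qed.

Definition boundary_incl m : hom (boundary m) F[m] := sub_incl _.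

Definition degenerate (K : sset) j (x : K j) :=
  exists i (s : dmap j i) (y : K i),
    [/\ i < j, forall u, exists v, s v = u & x = sres s y].

Definition nondegenerate (K : sset) j (x : K j) := ~ degenerate x.

(* the degenerate [j]-simplex at the vertex [a] *)
Definition cst (K : sset) (a : K 0) j : K j := sres (dmap_const j ord0) a.

Record bisset := BiSset { bcar :> sset; bini : bcar 0; bfin : bcar 0 }.

Definition bisimplex m : bisset := @BiSset F[m] (vertex ord0) (vertex ord_max).

Lemma sres_cst (K : sset) (a : K 0) i j (f : dmap i j) :
  sres f (cst a j) = cst a i.
Proof.
by rewrite /cst /sres -(@resM Delta K); congr (@res Delta K _ _ _ a); apply: dmap_eq.
Qed.

Lemma cst0 (K : sset) (a : K 0) : cst a 0 = a.
Proof.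
rewrite /cst -[RHS](@res1 Delta K); congr (@res Delta K _ _ _ a).
by apply: dmap_eq => x; rewrite [RHS]ord1.
Qed.

Lemma papp_sres (K K' : sset) (f : hom K K') i j (s : dmap i j) (x : K j) :
  papp f (sres s x) = sres s (papp f x).
Proof. exact: (@papp_res Delta K K' f i j s x). Qed.

(* The wedge [A \/ B] at [bfin A] and [bini B], realized inside [A * B];
   [wedge_pushout] below shows that it is the gluing of [A] and [B]. *)
Program Definition wedge_sset (A B : bisset) : sset :=
  @sub_psh Delta (prod_psh A B)
    (fun j p => p.1 = cst (bfin A) j \/ p.2 = cst (bini B) j) _.
Next Obligation.
move=> A B a b f [x y] [] /= ->; [left|right]; exact: sres_cst.
Qed.

Program Definition wedge_l (A B : bisset) : hom (A : sset) (wedge_sset A B) :=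
  @mk_pmap Delta A (wedge_sset A B)
    (fun j x => exist _ (x, cst (bini B) j) (or_intror erefl)) _.
Next Obligation.
by move=> A B a b f x; apply: eq_exist; congr pair; exact: esym (sres_cst _ f).
Qed.

Program Definition wedge_r (A B : bisset) : hom (B : sset) (wedge_sset A B) :=
  @mk_pmap Delta B (wedge_sset A B)
    (fun j y => exist _ (cst (bfin A) j, y) (or_introl erefl)) _.
Next Obligation.
by move=> A B a b f x; apply: eq_exist; congr pair; exact: esym (sres_cst _ f).
Qed.

Definition wedge (A B : bisset) : bisset :=
  @BiSset (wedge_sset A B) (papp (wedge_l A B) (bini A))
    (papp (wedge_r A B) (bfin B)).

Program Definition point (K : sset) (a : K 0) : hom F[0] K :=
  @mk_pmap Delta F[0] K (fun j _ => cst a j) _.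
Next Obligation. by move=> K a i j f s; exact: esym (sres_cst _ f). Qed.

Lemma wedge_pushout (A B : bisset) :
  is_pushout (point (bfin A)) (point (bini B)) (wedge_l A B) (wedge_r A B).
Proof.
split; first by apply: pmap_eq => j s; apply: eq_exist.
move=> Z u v uv.
have glue j : papp u (cst (bfin A) j) = papp v (cst (bini B) j).
  exact: (congr1 (fun h : hom F[0] Z => papp h (dmap_const j ord0 : F[0] j)) uv).
pose h j (p : wedge_sset A B j) : Z j :=
  if asbool ((sval p).2 = cst (bini B) j) then papp u (sval p).1
  else papp v (sval p).2.
have hr j p : (sval p).1 = cst (bfin A) j -> h j p = papp v (sval p).2.
  by rewrite /h => p1; case: asboolP => // ->; rewrite p1 glue.
have hl j p : (sval p).2 = cst (bini B) j -> h j p = papp u (sval p).1.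
  by rewrite /h => p2; case: asboolP.
have hn (i j : Delta) (f : hom i j) (p : wedge_sset A B j) :
    h i (res f p) = res f (h j p).
  case: (svalP p) => p1.
  - rewrite (hr _ _ p1) (hr i); last by rewrite /= p1; exact: sres_cst.
    exact: (papp_res v f).
  - rewrite (hl _ _ p1) (hl i); last by rewrite /= p1; exact: sres_cst.
    exact: (papp_res u f).
exists (mk_pmap hn); split.
  split; apply: pmap_eq => j x; first exact: (hl j).
  exact: (hr j).
move=> g [gl gr]; apply: pmap_eq => j p; case: (svalP p) => e.
- have -> : p = papp (wedge_r A B) (sval p).2.
    by case: p e => [[x y] xy] /= e; apply: eq_exist; rewrite /= e.
  by apply: etrans (hr j (papp (wedge_r A B) _) erefl) _; rewrite -gr.
- have -> : p = papp (wedge_l A B) (sval p).1.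
    by case: p e => [[x y] xy] /= e; apply: eq_exist; rewrite /= e.
  by apply: etrans (hl j (papp (wedge_l A B) _) erefl) _; rewrite -gl.
Qed.

(* [F[m] \/ F[m_2] \/ ... \/ F[m_t]] for [s = m_2, ..., m_t] *)
Fixpoint neck (m : nat) (s : seq nat) : bisset :=
  if s is m' :: s' then wedge (bisimplex m) (neck m' s') else bisimplex m.

Fixpoint beads (m : nat) (s : seq nat) : seq {j : nat & hom F[j] (neck m s)} :=
  match s with
  | [::] => [:: existT (fun j => hom F[j] (neck m [::])) m (idm F[m])]
  | m' :: s' =>
      existT (fun j => hom F[j] (neck m (m' :: s'))) m
        (wedge_l (bisimplex m) (neck m' s')) ::
      [seq existT (fun j => hom F[j] (neck m (m' :: s'))) (projT1 b)
             (wedge_r (bisimplex m) (neck m' s') ∘ projT2 b) | b <- beads m' s']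
  end.

Record necklace := Necklace {
  nfirst : nat;
  nrest : seq nat;
  npos : (0 < size nrest) ==> all (ltn 0) (nfirst :: nrest) }.

Definition nset (T : necklace) : bisset := neck (nfirst T) (nrest T).

Section Nec.
Variables (K : sset) (a b : K 0).

Record nec := NecOver {
  ncarrier : necklace;
  nmap : hom (nset ncarrier : sset) K;
  nini : papp nmap (bini (nset ncarrier)) = a;
  nfin : papp nmap (bfin (nset ncarrier)) = b }.

Definition nec_hom (T U : nec) :=
  {f : hom (nset (ncarrier T) : sset) (nset (ncarrier U)) |
    [/\ papp f (bini (nset (ncarrier T))) = bini (nset (ncarrier U)),
        papp f (bfin (nset (ncarrier T))) = bfin (nset (ncarrier U))
      & nmap U ∘ f = nmap T]}.

Program Definition Nec : category :=
  @Category nec nec_hom (fun T => exist _ (idm _) _)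
    (fun T U V g f => exist _ (sval g ∘ sval f) _) _ _ _.
Next Obligation. by move=> T; split=> //; rewrite ccompm1. Qed.
Next Obligation.
move=> T U V [g [gi gf gK]] [f [fi ff fK]] /=; split.
- by rewrite -gi -fi.
- by rewrite -gf -ff.
- by rewrite -fK -gK; exact: (@ccompA sset).
Qed.
Next Obligation. by move=> *; apply: eq_exist; exact: (@ccompA sset). Qed.
Next Obligation.
by move=> T U [f fP]; apply: eq_exist; exact: (@ccomp1m sset).
Qed.
Next Obligation.
by move=> T U [f fP]; apply: eq_exist; exact: (@ccompm1 sset).
Qed.

(* A map [F[j] -> K] is identified with the [j]-simplex which is the image of
   the identity of [j]. *)
Definition totally_nondegenerate (T : Nec) :=
  List.Forall
    (fun c => nondegenerate
                (papp (nmap T ∘ projT2 c) (dmap_id (projT1 c) : F[_] _)))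
    (beads (nfirst (ncarrier T)) (nrest (ncarrier T))).

Definition Nec_tnd : category := full_sub totally_nondegenerate.

End Nec.

Section NecMap.
Variables (K K' : sset) (q : hom K K') (a b : K 0) (a' b' : K' 0).
Hypotheses (qa : papp q a = a') (qb : papp q b = b').

Program Definition Nec_map_ob (T : nec a b) : nec a' b' :=
  @NecOver K' a' b' (ncarrier T) (q ∘ nmap T) _ _.
Next Obligation. by move=> T; exact: etrans (congr1 (fun x => papp q x) (nini T)) qa. Qed.
Next Obligation. by move=> T; exact: etrans (congr1 (fun x => papp q x) (nfin T)) qb. Qed.

Program Definition Nec_map : functor (Nec a b) (Nec a' b') :=
  @Functor (Nec a b) (Nec a' b') Nec_map_ob
    (fun T U f => exist _ (sval f) _) _ _.
Next Obligation.
by move=> T U [f [fi ff fK]]; split=> //=; rewrite -fK; exact: esym (@ccompA sset _ _ _ _ _ _ _).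
Qed.
Next Obligation. by move=> T; apply: eq_exist. Qed.
Next Obligation. by move=> T U V g f; apply: eq_exist. Qed.

Definition preserves_nondegenerate :=
  forall j (x : K j), nondegenerate x -> nondegenerate (papp q x).

Hypothesis q_nd : preserves_nondegenerate.

Lemma Nec_map_tnd (T : Nec a b) :
  totally_nondegenerate T -> totally_nondegenerate (Nec_map T).
Proof. by apply: List.Forall_impl => c; exact: q_nd. Qed.

Definition Nec_tnd_map : functor (Nec_tnd a b) (Nec_tnd a' b') :=
  full_restrict (F := Nec_map) Nec_map_tnd.

End NecMap.

(* Presheaves of simplicial sets on [Theta n] are uncurried: [X (theta, k)] is
   the set of [k]-simplices of [X(theta)]. Likewise, [W (m, (theta, k))]. *)
Definition cells (n : nat) : category := prod_cat (Theta n) Delta.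
Definition spaces (n : nat) : category := psh (cells n).
Definition sspaces (n : nat) : category := psh (prod_cat Delta (cells n)).

Section PCat.
Variable n : nat.

Definition level (m : nat) : functor (sspaces n) (spaces n) :=
  precomp (@left_at Delta (cells n) m).

Definition slice (theta : Theta n) (k : nat) : functor (sspaces n) sset :=
  precomp (@right_at Delta (cells n) (theta, k)).

(* objects constant in the missing variables *)
Definition of_sset : functor sset (sspaces n) :=
  precomp (fst_functor Delta (cells n)).

Definition of_space : functor (spaces n) (sspaces n) :=
  precomp (snd_functor Delta (cells n)).

Definition PCat : category := full_sub (fun W : sspaces n => discrete (level 0 W)).

Definition PCat_incl : functor PCat (sspaces n) := full_incl _.

Lemma of_sset_discrete (K : sset) : discrete (level 0 (of_sset K)).
Proof.
have r1 (x : K 0) : sres (idm (0 : Delta)) x = x by exact: (@res1 Delta K).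
exists (K 0).
have fP (a b : cells n) (f : hom a b) (x : level 0 (of_sset K) b) :
    res f x = x :> K 0 by exact: r1.
exists (@mk_pmap (cells n) (level 0 (of_sset K)) (const_psh _ (K 0))
  (fun a x => x) fP).
exists (@mk_pmap (cells n) (const_psh _ (K 0)) (level 0 (of_sset K))
  (fun a x => x) (fun a b f x => esym (r1 x))).
by split; apply: pmap_eq.
Qed.

Definition PCat_sset (K : sset) : PCat :=
  exist _ (of_sset K) (of_sset_discrete K).

(* the product, [K] and [X] being viewed as constant in the other variables *)
Definition box (K : sset) (X : spaces n) : sspaces n :=
  prod_psh (of_sset K) (of_space X).

Definition box_map (K K' : sset) (X X' : spaces n) (f : hom K K')
    (g : hom X X') : hom (box K X) (box K' X') :=
  prod_pmap (fmap of_sset f) (fmap of_space g).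

Definition box_proj (K : sset) (X : spaces n) : hom (box K X) (of_sset K) :=
  proj1_psh _ _.

Variables (L : functor (sspaces n) PCat) (adj : adjunction L PCat_incl).
Variables (m : nat) (X Y : spaces n) (i : hom X Y).

Record Pm := PmPushout {
  Pob :> PCat;
  Pl : hom (L (box (boundary m) Y)) Pob;
  Pr : hom (L (box F[m] X)) Pob;
  P_pushout : is_pushout (fmap L (box_map (idm (boundary m)) i))
                         (fmap L (box_map (boundary_incl m) (idm X))) Pl Pr }.

(* [Q] restricts to the adjuncts of the projections on the two legs; it is
   unique by [P_pushout] and [unit_univ]. *)
Definition is_Q (P : Pm) (Q : hom (P : PCat) (PCat_sset F[m])) :=
  fmap PCat_incl (Q ∘ Pl P) ∘ unit_adj adj _
    = fmap of_sset (boundary_incl m) ∘ box_proj (boundary m) Y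
  /\ fmap PCat_incl (Q ∘ Pr P) ∘ unit_adj adj _ = box_proj F[m] X.

Definition P_slice (P : Pm) theta k : sset := slice theta k (PCat_incl P).

(* the identity in each degree; both sides are not convertible as presheaves *)
Definition slice_of_sset (K : sset) theta k :
    hom (slice theta k (of_sset K)) K :=
  @mk_pmap Delta (slice theta k (of_sset K)) K (fun _ x => x)
    (fun _ _ _ _ => erefl).

Definition Q_slice (P : Pm) (Q : hom (P : PCat) (PCat_sset F[m])) theta k :
    hom (P_slice P theta k) F[m] :=
  slice_of_sset F[m] theta k ∘ fmap (slice theta k) (fmap PCat_incl Q).

Lemma Theta_hom (r : nat) (a b : Theta r) : exists f : hom a b, True.
Proof.
case: r a b => [|r] a b; first by exists tt.
unshelve eexists; last by [].
apply: (@WHom (Theta r) a b (dmap_const _ ord0)) => u v.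
by move=> /andP[_].
Qed.

Lemma cells_hom (a b : cells n) : exists f : hom a b, True.
Proof.
have [f _] := Theta_hom a.1 b.1.
by exists (f, dmap_const a.2 (ord0 : 'I_b.2.+1)).
Qed.

Lemma discrete_inj (Z : spaces n) (S : set_cat) (f : hom Z (const_psh _ S)) a :
  is_iso f -> injective (fun z : Z a => papp f z).
Proof.
move=> [g [gf _]] x y /(congr1 (fun s => @papp _ (const_psh _ S) Z g a s)).
have E z : @papp _ (const_psh _ S) Z g a (papp f z) = z.
  exact: (congr1 (fun h : hom Z Z => papp h z) gf).
by rewrite !E.
Qed.

Section Facts.
Variables (P : Pm) (Q : hom (P : PCat) (PCat_sset F[m])).
Arguments Pob : simpl never.

Let W : sspaces n := PCat_incl P.
Let eta Z : hom Z (PCat_incl (L Z)) := unit_adj adj Z.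
Let l : hom (box (boundary m) Y) W := fmap PCat_incl (Pl P) ∘ eta _.
Let r : hom (box F[m] X) W := fmap PCat_incl (Pr P) ∘ eta _.

Let lr : l ∘ box_map (idm (boundary m)) i = r ∘ box_map (boundary_incl m) (idm X).
Proof.
rewrite /l /r /eta -!(@ccompA (sspaces n)) !(unit_nat adj) !(@ccompA (sspaces n)).
congr (_ ∘ _); exact: (P_pushout P).1.
Qed.

(* The images of the two legs form a discrete-at-level-0 subobject, hence are
   everything. *)
Lemma P_cover (c : prod_cat Delta (cells n)) (w : W c) :
  (exists u, w = papp l u) \/ (exists v, w = papp r v).
Proof.
pose I (c : prod_cat Delta (cells n)) (w : W c) :=
  (exists u, w = papp l u) \/ (exists v, w = papp r v).
have IR (a b : prod_cat Delta (cells n)) (f : hom a b) (x : W b) :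
    I b x -> I a (res f x).
  by case=> -[u ->]; [left|right]; exists (res f u); rewrite (papp_res _ f).
pose V : sspaces n := sub_psh IR.
have Vd : discrete (level 0 V).
  have [S [f fi]] := svalP (Pob P); have [g [gf fg]] := fi.
  pose S' : set_cat := {s : S | exists c (x : level 0 V c), papp f (sval x : level 0 W c) = s}.
  have gfE c' (z : level 0 W c') : @papp _ (const_psh _ S) (level 0 W) g c' (papp f z) = z.
    exact: (congr1 (fun h : hom (level 0 W) (level 0 W) => papp h z) gf).
  have fgE c' (s : S) : papp f (@papp _ (const_psh _ S) (level 0 W) g c' s) = s.
    exact: (congr1 (fun h : hom (const_psh _ S) (const_psh _ S) => @papp (cells n) _ _ h c' s) fg).
  have Ig c' (s : S') : I (0, c') (@papp _ (const_psh _ S) (level 0 W) g c' (sval s)).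
    case: s => s [c0 [x xs]] /=; have [h _] := cells_hom c' c0.
    have -> : @papp _ (const_psh _ S) (level 0 W) g c' s = @res (prod_cat Delta (cells n)) W (0, c') (0, c0)
      (idm (0 : Delta), h) (sval x).
      rewrite -[RHS](gfE c'); congr (papp g _).
      by rewrite -xs; exact: esym (papp_res f h (sval x)).
    exact: (IR (0, c') (0, c0) _ _ (svalP x)).
  have If c' (x : level 0 V c') : exists c (y : level 0 V c),
      papp f (sval y : level 0 W c) = papp f (sval x : level 0 W c').
    by exists c', x.
  exists S'.
  unshelve eexists.
    apply: (@mk_pmap (cells n) (level 0 V) (const_psh _ S') (fun c' x => exist _ (papp f (sval x : level 0 W c')) (If c' x))).
    move=> a b h x; apply: eq_exist.
    exact: (papp_res f h (sval x : level 0 W b)).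
  unshelve eexists.
    apply: (@mk_pmap (cells n) (const_psh _ S') (level 0 V) (fun c' s => exist _ _ (Ig c' s))).
    move=> a b h s; apply: eq_exist.
    exact: (papp_res g h).
  split; apply: pmap_eq => c' x.
    case: x => x Ix; apply: eq_exist; exact: gfE.
  case: x => x Ix; apply: eq_exist; exact: fgE.
pose VP : PCat := exist _ V Vd.
pose io : hom V W := sub_incl IR.
have iom Z (g h : hom Z V) : io ∘ g = io ∘ h -> g = h.
  move=> gh; apply: pmap_eq => a z.
  have : sval (papp g z) = sval (papp h z).
    exact: (congr1 (fun t : hom Z W => papp t z) gh).
  by case: (papp g z) (papp h z) => [x Ix] [y Iy] /= xy; exact: eq_exist.
pose l0 : hom (box (boundary m) Y) V :=
  @mk_pmap _ (box (boundary m) Y) V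
    (fun a x => exist _ (papp l x) (or_introl (ex_intro _ x erefl)))
    (fun a b f x => eq_exist _ _ (papp_res l f x)).
pose r0 : hom (box F[m] X) V :=
  @mk_pmap _ (box F[m] X) V
    (fun a x => exist _ (papp r x) (or_intror (ex_intro _ x erefl)))
    (fun a b f x => eq_exist _ _ (papp_res r f x)).
have iol0 : io ∘ l0 = l by apply: pmap_eq.
have ior0 : io ∘ r0 = r by apply: pmap_eq.
have [l1 [l1E _]] := @unit_univ _ _ _ _ adj _ VP l0.
have [r1 [r1E _]] := @unit_univ _ _ _ _ adj _ VP r0.
have etaI Z (D : PCat) (g h : hom (L Z) D) :
    fmap PCat_incl g ∘ eta Z = fmap PCat_incl h ∘ eta Z -> g = h.
  move=> gh; have [k [_ ku]] := @unit_univ _ _ _ _ adj Z D (fmap PCat_incl h ∘ eta Z).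
  by rewrite -(ku h erefl) -(ku g gh).
have io1 : (io : hom VP (P : PCat)) ∘ l1 = Pl P.
  apply: etaI; rewrite fmapM -(@ccompA (sspaces n)) [X in _ ∘ X]l1E; exact: iol0.
have io2 : (io : hom VP (P : PCat)) ∘ r1 = Pr P.
  apply: etaI; rewrite fmapM -(@ccompA (sspaces n)) [X in _ ∘ X]r1E; exact: ior0.
have [PE Pu] := P_pushout P.
have lr1 : l1 ∘ fmap L (box_map (idm (boundary m)) i)
         = r1 ∘ fmap L (box_map (boundary_incl m) (idm X)).
  apply: (iom (PCat_incl (L _))).
  move: PE; rewrite -io1 -io2 -!(@ccompA PCat); exact.
have [h [[hl hr] _]] := Pu VP l1 r1 lr1.
have ioh : (io : hom VP (P : PCat)) ∘ h = idm _.
  have [k [_ ku]] := Pu P (Pl P) (Pr P) PE.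
  rewrite -(ku (idm _)) ?ccomp1m //; apply: esym; apply: ku.
  by rewrite -!(@ccompA PCat) hl hr.
have -> : w = sval (@papp _ W V h _ w).
  exact: esym (congr1 (fun t : hom W W => papp t w) ioh).
exact: (svalP (@papp _ W V h _ w)).
Qed.

Hypothesis hQ : is_Q Q.

Lemma Q_l c (u : box (boundary m) Y c) :
  papp (fmap PCat_incl Q) (papp l u) = sval u.1.
Proof.
have := hQ.1; rewrite fmapM -(@ccompA (sspaces n)) => e.
exact: (congr1 (fun t : hom (box (boundary m) Y) (of_sset F[m]) => papp t u) e).
Qed.

Lemma Q_r c (v : box F[m] X c) : papp (fmap PCat_incl Q) (papp r v) = v.1.
Proof.
have := hQ.2; rewrite fmapM -(@ccompA (sspaces n)) => e.
exact: (congr1 (fun t : hom (box F[m] X) (of_sset F[m]) => papp t v) e).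
Qed.

Lemma in_boundary_surj j k (s : dmap j k) (t : F[m] k) :
  (forall u, exists v, s v = u) ->
  in_boundary (sres s t : F[m] j) -> in_boundary t.
Proof. by move=> ss [o st]; exists o => x; have [y <-] := ss x; exact: st. Qed.

Lemma Q_nondegenerate theta k : preserves_nondegenerate (Q_slice Q theta k).
Proof.
move=> j p pnd [k' [s [t [kj ss e]]]]; apply: pnd; exists k', s.
have h (a : spaces n) (y : a (theta, k)) : res (idm ((theta, k) : cells n)) y = y.
  exact: res1.
case: (P_cover (c := (j, (theta, k))) p) => -[[b y] pE].
- have be : sval b = sres s t.
    rewrite -e pE; exact: esym (Q_l (c := (j, (theta, k))) (b, y)).
  have tb : in_boundary t by apply: (in_boundary_surj ss); rewrite -be; exact: svalP b.
  exists (@papp _ _ W l (k', (theta, k)) (exist _ t tb, y)); split=> //.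
  rewrite pE; apply: etrans (@papp_res _ _ W l (j, (theta, k)) (k', (theta, k)) (s, idm _) (exist _ t tb, y)).
  congr (papp l _); congr pair; last exact: esym (h Y y).
  by case: b be {pE} => b bb /= be; exact: eq_exist.
- have be : b = sres s t.
    rewrite -e pE; exact: esym (Q_r (c := (j, (theta, k))) (b, y)).
  exists (@papp _ _ W r (k', (theta, k)) (t, y)); split=> //.
  rewrite pE; apply: etrans (@papp_res _ _ W r (j, (theta, k)) (k', (theta, k)) (s, idm _) (t, y)).
  by congr (papp r _); congr pair => //; exact: esym (h X y).
Qed.

Hypotheses (m_gt0 : 0 < m) (Yc : connected Y).

Lemma connected_inh c : exists y : Y c, True.
Proof.
apply: contrapT => noY; have [S [u [uU [s _]]]] := Yc.
have [g [_ gu]] := uU bool (fmap (const_psh _) (fun=> true) ∘ u).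
have E : fmap (const_psh (cells n)) (fun=> false : bool) ∘ u
       = fmap (const_psh _) (fun=> true) ∘ u.
  apply: pmap_eq => c' y; have [h _] := cells_hom c c'.
  by case: noY; exists (res h y).
have e : (fun _ : S => true) = (fun=> false).
  by rewrite -(gu _ erefl) -(gu _ E).
by have := congr1 (@^~ s) e.
Qed.

Lemma vertex_boundary (o : 'I_m.+1) : in_boundary (vertex o).
Proof.
have [oE|oN] := eqVneq o ord0.
  by exists ord_max => x /=; rewrite oE -val_eqE /= eq_sym -lt0n.
by exists ord0.
Qed.

Lemma P_vertex theta k (o : 'I_m.+1) :
  exists! v : P_slice P theta k 0, papp (Q_slice Q theta k) v = vertex o.
Proof.
pose vb : boundary m 0 := exist _ (vertex o) (vertex_boundary o).
have pl c p : papp (fmap PCat_incl Q) (p : W (0, c)) = vertex o ->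
    exists y : Y c, p = @papp _ _ W l (0, c) (vb, y).
  case: (P_cover p) => -[[b y] ->]; rewrite ?Q_l ?Q_r /= => bo.
    by exists y; congr (papp l _); congr pair; case: b bo => b bb /= bo; exact: eq_exist.
  exists (papp i y); rewrite bo.
  exact: esym (congr1 (fun h : hom (box (boundary m) X) W =>
                 @papp _ _ W h (0, c) (vb, y)) lr).
have tn (a b : cells n) (f : hom a b) (y : Y b) :
    @papp _ _ W l (0, a) (vb, res f y)
    = @res _ (level 0 W) _ _ f (@papp _ _ W l (0, b) (vb, y)).
  apply: etrans (papp_res l (_ : @hom (prod_cat Delta (cells n)) (0, a) (0, b)) _).
  by congr (papp l _); congr pair; exact: esym (@res1 Delta (boundary m) 0 vb).
pose t : hom Y (level 0 W) :=
  @mk_pmap _ Y (level 0 W) (fun c y => @papp _ _ W l (0, c) (vb, y)) tn.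
have tc c (y y' : Y c) : papp t y = papp t y'.
  have [S [f fi]] := svalP (Pob P); apply: (discrete_inj fi).
  have [S' [u [uU [s sU]]]] := Yc; have [g [gE _]] := uU S (f ∘ t).
  have E z : papp f (papp t z) = g (papp u z) :> S.
    exact: esym (congr1 (fun h : hom Y (const_psh _ S) => papp h z) gE).
  by rewrite /= E E (sU (papp u y)) (sU (papp u y')).
have [y _] := connected_inh (theta, k).
exists (@papp _ _ W l (0, (theta, k)) (vb, y)); split.
  exact: (@Q_l (0, (theta, k)) (vb, y)).
by move=> p /pl[y' ->]; exact: tc.
Qed.

(* By [P_vertex], [Q] identifies the vertices of each slice of [P] with
   0, ..., m; this is the vertex [o]. *)
Definition P_vtx theta k (o : 'I_m.+1) : P_slice P theta k 0 :=
  sval (cid (P_vertex theta k o)).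

Lemma Q_vtx theta k o : papp (Q_slice Q theta k) (P_vtx theta k o) = vertex o.
Proof. by rewrite /P_vtx; case: cid => v []. Qed.

Definition Q_tnd theta k :
    functor (Nec_tnd (P_vtx theta k ord0) (P_vtx theta k ord_max))
            (Nec_tnd (vertex ord0) (vertex (@ord_max m))) :=
  Nec_tnd_map (Q_vtx theta k ord0) (Q_vtx theta k ord_max)
    (@Q_nondegenerate theta k).

End Facts.

End PCat.

(* Main.v *)
(* A lift of [f : b -> p e] must be the necklace [e] precomposed with [f]. It is
   totally non-degenerate because simplicial maps preserve degenerate simplices
   and its image [b] is totally non-degenerate; so post-composition with any
   simplicial map preserving non-degenerate simplices is a discrete fibration. *)
Require Import Defs.
From mathcomp Require Import all_boot.
From mathcomp Require Import boolp.

Set Implicit Arguments.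
Unset Strict Implicit.
Unset Printing Implicit Defensive.

Lemma degenerate_papp (K K' : sset) (q : hom K K') j (x : K j) :
  degenerate x -> degenerate (papp q x).
Proof.
move=> [i [s [y [ij ss ->]]]]; exists i, s, (papp q y).
by split=> //; exact: papp_sres.
Qed.

Lemma totally_nondegenerate_reflect (K K' : sset) (q : hom K K') (a b : K 0)
    (a' b' : K' 0) (qa : papp q a = a') (qb : papp q b = b') (T : Nec a b) :
  totally_nondegenerate (Nec_map qa qb T) -> totally_nondegenerate T.
Proof. by apply: List.Forall_impl => c nd /(@degenerate_papp _ _ q). Qed.

(** Proof irrelevance makes every loop at [i] trivial, so [I] needs no decidable equality. *)
Lemma existT_inj2 (I : Type) (A : I -> Type) (i : I) (x y : A i) :
  existT A i x = existT A i y -> x = y.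
Proof.
by move=> xy; have := projT2_eq xy; rewrite (Prop_irrelevance (projT1_eq xy) erefl).
Qed.

Lemma nec_eq (K : sset) (a b : K 0) c (f g : hom (nset c : sset) K) fi gi ff gf :
  f = g -> @NecOver K a b c f fi ff = @NecOver K a b c g gi gf.
Proof.
move=> fg; move: gi gf; rewrite -fg => gi gf.
by rewrite (Prop_irrelevance fi gi) (Prop_irrelevance ff gf).
Qed.

(** Keeps exactly the data that post-composition with [q] leaves untouched, so arrows into [e] and
    into its image can be compared. *)
Definition underlying_map (K : sset) (a b : K 0) (e : Nec_tnd a b)
    (x : {e' : Nec_tnd a b & hom e' e}) :
    {c : necklace & hom (nset c : sset) (nset (ncarrier (sval e)))} :=
  existT (fun c => hom (nset c : sset) (nset (ncarrier (sval e))))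
    (ncarrier (sval (projT1 x))) (sval (projT2 x)).

(* The structure map of a necklace [e'] over [e] is the composite of
   [e' -> e] with that of [e]. *)
Lemma underlying_map_inj (K : sset) (a b : K 0) (e : Nec_tnd a b) :
  injective (@underlying_map K a b e).
Proof.
move=> [[[c u ui uf] ut] [f fP]] [[[c' v vi vf] vt] [g gP]].
rewrite /underlying_map /= in f fP g gP * => E.
have cc : c = c' by exact: projT1_eq E.
case: _ / cc in v vi vf vt g gP E *.
have fg : f = g by exact: existT_inj2 E.
case: _ / fg in gP {E} *.
have uv : u = v by case: fP gP => _ _ <- [].
case: _ / uv in vi vf vt gP *.
have vE := Prop_irrelevance vi ui; case: _ / (esym vE) in vt gP *.
have wE := Prop_irrelevance vf uf; case: _ / (esym wE) in vt gP *.
have tE := Prop_irrelevance vt ut; case: _ / (esym tE) in gP *.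
by congr existT; exact: eq_exist.
Qed.

Lemma Nec_tnd_map_discrete_fibration (K K' : sset) (q : hom K K') (a b : K 0)
    (a' b' : K' 0) (qa : papp q a = a') (qb : papp q b = b')
    (q_nd : preserves_nondegenerate q) :
  discrete_fibration (Nec_tnd_map qa qb q_nd).
Proof.
move=> e [[c u ui uf] ut] [f fP]; have [fi ff fu] := fP.
have Ti : papp (nmap (sval e) ∘ f) (bini (nset c)) = a.
  exact: etrans (congr1 (fun x => papp (nmap (sval e)) x) fi) (nini (sval e)).
have Tf : papp (nmap (sval e) ∘ f) (bfin (nset c)) = b.
  exact: etrans (congr1 (fun x => papp (nmap (sval e)) x) ff) (nfin (sval e)).
pose T : Nec a b := NecOver Ti Tf.
(* Both have carrier [c]; by [fu] the structure map [u] is that of [e] followed by [q], precomposed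
   with [f]. *)
have TU : Nec_map qa qb T = NecOver ui uf.
  by apply: nec_eq; apply: etrans fu; exact: (@ccompA sset).
have Tt : totally_nondegenerate T.
  by apply: (@totally_nondegenerate_reflect _ _ q _ _ _ _ qa qb); rewrite TU.
exists (existT (fun e' : Nec_tnd a b => hom e' e)
  (exist _ T Tt : Nec_tnd a b) (exist _ f (And3 fi ff erefl))).
(* Both sides have underlying map [f] by computation. *)
split; first exact: underlying_map_inj.
move=> x xE; apply: underlying_map_inj.
(* The underlying map of [x] is convertible to that of its image, which [xE] identifies with [f]. *)
exact: esym (congr1 (@underlying_map _ _ _ (Nec_tnd_map qa qb q_nd e)) xE).
Qed.

Theorem proposition3p2p5
    (n : nat) (n_ge1 : 1 <= n) (m : nat) (m_ge1 : 1 <= m)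
    (L : functor (sspaces n.-1) (PCat n.-1))
    (adj : adjunction L (PCat_incl n.-1))
    (X Y : spaces n.-1) (Y_connected : connected Y)
    (i : hom X Y) (i_mono : mono i)
    (P : Pm L m i) (Q : hom (Pob P) (PCat_sset n.-1 F[m])) (Q_ind : is_Q adj Q)
    (theta : Theta n.-1) (k : nat) :
  discrete_fibration (Q_tnd Q_ind m_ge1 Y_connected theta k).
(* [Q_tnd] unfolds to [Nec_tnd_map] for [Q_slice Q theta k], with [Q_nondegenerate] as the
   preservation hypothesis. *)
Proof. exact: Nec_tnd_map_discrete_fibration. Qed.
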